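(* Let $\mathbf X(t)=\int_{-\infty}^{t}e^{\mathbf A(t-u)}\mathbf e\,dS(u)$ and $Y(t)=\mathbf b'\mathbf X(t)$, $t\in\mathbb R$, where $\mathbf A,\mathbf e,\mathbf b$ and the semi-Levy process $S$ of period $T$ are as described in the context. Then the expected value of $\mathbf X(t)$ is periodic with period $T$, that is, $$E[\mathbf X(t+T)]=E[\mathbf X(t)]\quad\text{for all } t\in\mathbb R,$$ and consequently the expected value of $Y(t)$ is also periodic with period $T$: $E[Y(t+T)]=E[Y(t)]$ for all $t\in\mathbb R$.
   Context: Driving process: let $r\in\mathbb N$ and $0=s_0<s_1<s_2<\cdots$ be such that the intervals $B_i=(s_{i-1},s_i]$, $i\in\mathbb N$, partition $(0,\infty)$ and $|B_{i+kr}|=|B_i|$ for all $i,k\in\mathbb N$; let $\lambda_i>0$ with $\lambda_{i+kr}=\lambda_i$. Put $a_i=|B_i|$ and $T=\sum_{i=1}^r a_i$. Let $\ell:\mathbb R\to(0,\infty)$ be the $T$-periodic function equal to $\lambda_i/a_i$ on $B_i$. Let $M$ be a Poisson random measure on $\mathbb R$ with mean measure $\ell(u)\,du$, and let its atoms carry i.i.d. real marks (jumps) distributed as a random variable $J$ with $E[J^2]<\infty$, independent of $M$. Let $\gamma\in\mathbb R$. The process $S=\{S(t),t\in\mathbb R\}$ satisfies $S(0)=0$ and, for $s<t$, $S(t)-S(s)=\gamma(t-s)+{}$(the sum of the jumps attached to the atoms of $M$ in $(s,t]$). Thus for $t\ge0$, $S(t)=\gamma t+\sum_{k=1}^{N(t)}J_k$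 with $N(t)=M(0,t]$ and $J_k$ i.i.d. copies of $J$; $S$ has independent increments which are periodically stationary with period $T$, i.e. $S(t+T)-S(s+T)$ and $S(t)-S(s)$ have the same distribution. $S$ is assumed to be a second-order subordinator (nondecreasing, with finite second moments). CARMA coefficients: $0\le q<p$ are integers; $a(z)=z^p+a_1z^{p-1}+\cdots+a_p$ and $b(z)=b_0+b_1z+\cdots+b_{p-1}z^{p-1}$ have real coefficients, $b_q=1$, $b_j=0$ for $q<j<p$, and $a(z)$, $b(z)$ have no common factors (the $a_1,\dots,a_p$ here are not the lengths $a_i=|B_i|$). $\mathbf A$ is the $p\times p$ companion matrix with ones on the superdiagonal, last row $(-a_p,-a_{p-1},\dots,-a_1)$ and zeros elsewhere; $\mathbf e=(0,\dots,0,1)'\in\mathbb R^p$; $\mathbf b=(b_0,\dots,b_{p-1})'$; $'$ denotes transpose. All eigenvalues of $\mathbf A$ have negative real parts, and $\mathbf X(t)$ is independent of $\{S(v)-S(t):v>t\}$ for all $t\in\mathbb R$. The integral over $(-\infty,t]$ is the $L^2$-limit as $s\to-\infty$ of the integrals over $(s,t]$, which are taken as $L^2$-limits of Riemann–Stieltjes sums (equivalently pathwise). *)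

(* Defs.v *)
From HB Require Import structures.
From mathcomp Require Import all_boot all_order all_algebra.
From mathcomp Require Import finmap.
From mathcomp Require Import all_classical all_reals all_analysis.
From mathcomp Require Import measurable_realfun complex.

Set Implicit Arguments.
Unset Strict Implicit.
Unset Printing Implicit Defensive.

Import Order.TTheory GRing.Theory Num.Theory.
Import numFieldNormedType.Exports.

Local Open Scope classical_set_scope.
Local Open Scope ring_scope.

Section Independence.
Context d (Omega : measurableType d) (R : realType) (P : probability Omega R).
Local Open Scope ereal_scope.

Definition sigma_field d' (rT : measurableType d') (I : Type) (D : set I)
    (Z : I -> Omega -> rT) : set_system Omega :=
  <<s \bigcup_(i in D) g_sigma_algebra_preimage (Z i) >>.

Definition independent (F G : set_system Omega) : Prop :=
  forall A B, F A -> G B -> P (A `&` B) = P A * P B.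

Definition mutually_independent (I : choiceType) (F : I -> set_system Omega)
    : Prop :=
  forall (K : {fset I}) (A : I -> set Omega),
    (forall k, k \in K -> F k (A k)) ->
    P (\bigcap_(k in [set` K]) A k) = \prod_(k <- K) P (A k).

Definition iid_copies (I : choiceType) (Z : I -> {RV P >-> R})
    (J : {RV P >-> R}) : Prop :=
  mutually_independent (fun k => g_sigma_algebra_preimage (Z k)) /\
  (forall k B, measurable B -> distribution P (Z k) B = distribution P J B).

End Independence.

Section PoissonRandomMeasure.
Context d (Omega : measurableType d) (R : realType) (P : probability Omega R).
Local Open Scope ereal_scope.

(* The second argument of [poisson_prob] is a dummy. *)
Definition poisson_law (m : \bar R) (N : Omega -> \bar R) : Prop :=
  if m == +oo then P [set w | N w = +oo] = 1
  else forall n : nat,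
    P [set w | N w = n%:R%:E] = poisson_prob (fine m) 0 [set n].

Definition poisson_random_measure (M : R.-ker Omega ~> R)
    (m : set R -> \bar R) : Prop :=
  (forall B, measurable B -> poisson_law (m B) (fun w => M w B)) /\
  (forall (n : nat) (B : 'I_n -> set R),
    (forall i, measurable (B i)) -> trivIset setT B ->
    mutually_independent P
      (fun i => g_sigma_algebra_preimage (fun w => M w (B i)))).

Definition sigma_kernel (M : R.-ker Omega ~> R) : set_system Omega :=
  sigma_field measurable (fun (B : set R) w => M w B).

(* [tau] lists the atoms of [M] in increasing order, indexed by the integers
   so that the positive atoms are [tau 1], [tau 2], and so on. *)
Definition atoms (M : R.-ker Omega ~> R) (tau : int -> {RV P >-> R}) : Prop :=
  {ae P, forall w,
    [/\ forall k, (tau k w <= tau (k + 1)%R w)%R,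
        (tau 0%R w <= 0 < tau 1%R w)%R &
        forall B, measurable B -> M w B = \esum_(k in setT) \d_(tau k w) B]}.

End PoissonRandomMeasure.

Section Driving.
Context (R : realType).
Implicit Types (r : nat) (s lam : nat -> R).

Definition block s (i : nat) : set R := `]s i.-1, s i]%classic.

Definition block_length s (i : nat) : R := s i - s i.-1.

Definition period r s : R := \sum_(1 <= i < r.+1) block_length s i.

Record periodic_blocks r s : Prop := PeriodicBlocks {
  blocks_gt0 : (0 < r)%N;
  blocks_start : s 0%N = 0;
  blocks_incr : forall i, s i < s i.+1;
  blocks_partition :
    partition [set i | (0 < i)%N] (block s) `]0, +oo[%classic;
  blocks_periodic : forall i k, (0 < i)%N ->
    block_length s (i + k * r) = block_length s i }.

Record intensity r s lam (ell : R -> R) : Prop := Intensity {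
  intensity_rate_gt0 : forall i, (0 < i)%N -> 0 < lam i;
  intensity_rate_periodic : forall i k, (0 < i)%N -> lam (i + k * r)%N = lam i;
  intensity_gt0 : forall u, 0 < ell u;
  intensity_periodic : forall u, ell (u + period r s) = ell u;
  intensity_block : forall i u, (0 < i)%N -> block s i u ->
    ell u = lam i / block_length s i }.

Context d (Omega : measurableType d) (P : probability Omega R).

(* A finitely supported sum is 0 when its support is infinite; here this can
   only happen on a null event, since almost surely a Poisson random measure
   with locally bounded intensity has finitely many atoms in `]u, v]. *)
Definition marked_poisson_process (gamma : R) (tau J : int -> {RV P >-> R})
    (S : R -> {RV P >-> R}) : Prop :=
  {ae P, forall w, S 0 w = 0 /\
    forall u v, u < v -> S v w - S u w =
      gamma * (v - u) + \sum_(k \in [set k | u < tau k w <= v]) J k w}.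

Definition second_order_subordinator (S : R -> {RV P >-> R}) : Prop :=
  {ae P, forall w, {homo (fun t => S t w) : u v / u <= v}} /\
  (forall t, 'E_P[fun w => (S t w ^+ 2)%R] < +oo)%E.

End Driving.

Section StochasticIntegral.
Context d (Omega : measurableType d) (R : realType) (P : probability Omega R).
Context (p : nat).
Implicit Types (X Z : Omega -> 'cV[R]_p) (f : R -> 'cV[R]_p).

Definition L2_vector X : Prop := forall i, (fun w => X w i 0) \in Lfun P 2%:E.

Definition L2_dist X Z (i : 'I_p) : \bar R :=
  Lnorm P 2%:E (fun w => (X w i 0 - Z w i 0)%:E).

(* [u] lists the points after [a] of a partition of [a, b], and [xi] the tags
   of its cells. *)
Definition tagged_partition (a b delta : R) (u xi : seq R) : Prop :=
  [/\ itv_partition a b u, size xi = size u &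
      forall i, (i < size u)%N ->
        nth b (a :: u) i <= nth b xi i <= nth b u i /\
        nth b u i - nth b (a :: u) i < delta].

Definition stieltjes_sum f (S : R -> Omega -> R) (a b : R) (u xi : seq R)
    (w : Omega) : 'cV[R]_p :=
  \sum_(i < size u)
    (S (nth b u i) w - S (nth b (a :: u) i) w) *: f (nth b xi i).

Definition is_stieltjes_integral f (S : R -> Omega -> R) (a b : R) X : Prop :=
  L2_vector X /\
  forall (i : 'I_p) (eps : R), 0 < eps ->
    exists2 delta : R, 0 < delta & forall u xi,
      tagged_partition a b delta u xi ->
      (L2_dist (stieltjes_sum f S a b u xi) X i < eps%:E)%E.

Definition is_improper_integral f (S : R -> Omega -> R) (t : R) X : Prop :=
  L2_vector X /\
  exists2 I : R -> Omega -> 'cV[R]_p,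
    (forall s, s < t -> is_stieltjes_integral f S s t (I s)) &
    forall i, L2_dist (I s) X i @[s --> -oo%R] --> 0%E.

Definition mean_vector X : 'cV[\bar R]_p := \col_i 'E_P[fun w => X w i 0%R]%E.

End StochasticIntegral.

Section Carma.
Context (R : realType) (p : nat).
Implicit Types a b : nat -> R.

Definition expmx (A : 'M[R]_p) : 'M[R]_p :=
  limn (fun n => \sum_(k < n) (k`!%:R)^-1 *: A ^+ k).

(* The coefficients a_1, ..., a_p are [a 1], ..., [a p]; [a 0] is unused. *)
Definition ar_poly a : {poly R} :=
  'X^p + \sum_(1 <= k < p.+1) a k *: 'X^(p - k).

Definition ma_poly b : {poly R} := \poly_(j < p) b j.

(* This is [companionmx (ar_poly a)], but of a size syntactically equal to p. *)
Definition carma_mx a : 'M[R]_p :=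
  \matrix_(i < p, j < p)
    if i.+1 == p then - a (p - j)%N else (j == i.+1 :> nat)%:R.

Definition carma_input : 'cV[R]_p := \col_(i < p) (i.+1 == p)%:R.

Definition carma_output b : 'cV[R]_p := \col_(j < p) b j.

Definition stable_mx (A : 'M[R]_p) : Prop :=
  forall z : complex R,
    eigenvalue (map_mx (real_complex R) A) z -> complex.Re z < 0.

Record carma_coefficients (q : nat) a b : Prop := CarmaCoefficients {
  carma_order : (q < p)%N;
  carma_bq : b q = 1;
  carma_b0 : forall j, (q < j < p)%N -> b j = 0;
  carma_coprime : coprimep (ar_poly a) (ma_poly b);
  carma_stable : stable_mx (carma_mx a) }.

End Carma.
Arguments carma_input {R} p.

(* Main.v *)
Require Import Defs.
From HB Require Import structures.
From mathcomp Require Import all_boot all_order all_algebra.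
From mathcomp Require Import finmap.
From mathcomp Require Import all_classical all_reals all_analysis.
From mathcomp Require Import measurable_realfun.
From mathcomp Require Import lra ring.

Set Implicit Arguments.
Unset Strict Implicit.
Unset Printing Implicit Defensive.

Import Order.TTheory GRing.Theory Num.Theory.
Import numFieldNormedType.Exports.

Local Open Scope classical_set_scope.
Local Open Scope ring_scope.

(** The mean of a stochastic integral against [S] depends on [S] only through
    the means of its increments, so everything rests on the fact that these
    means are invariant under translation by the period [T].

    For the increments, Campbell's formula is used. Up to a null event, the
    position of the [k]-th atom of [M] relative to a given level is a function
    of the counts of [M] on intervals with an end at 0 ([atom_le_event]); hence
    the mark of that atom is independent of the event that the atom lies in
    [(u, v]] ([mark_atom_indep]). Summing over the atoms gives, for [g >= 0],
    that the sum of [g] over the marks found in [(u, v]] has mean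
    [E (g J) * E (M (u, v])] ([integral_marked_sum]). Applied to the positive
    and negative parts, this writes the mean increment as
    [gamma * (v - u) + E J * E (M (u, v])] ([mean_increment]). As [M (u, v]] is
    Poisson, its mean is a function of the integral of [ell] over [(u, v]],
    which is unchanged when both ends move by [T] since [ell] is [T]-periodic
    and Lebesgue measure is translation invariant
    ([mean_increment_periodic]).

    For the integrals, translate a tagged partition of [(s, t]] by [T]: as the
    kernel of [X] depends on [t - u] only, the two Riemann-Stieltjes sums have
    the same kernel values and increments of equal means, hence equal means.
    Convergence in [L2] under a probability entails convergence of means
    ([expectation_L2_dist]), so equality passes to the integrals over [(s, t]]
    and then to the limit [s --> -oo] ([expectation_improper_shift]). The mean
    of [Y] is a fixed linear combination of the means of the entries of [X]. *)

(** * Periodic intensities *)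

Section Intensity.
Context (R : realType).
Implicit Types (r : nat) (s lam : nat -> R) (ell : R -> R).

Lemma periodE r s : s 0%N = 0 -> period r s = s r.
Proof.
move=> s0; rewrite /period /block_length big_add1 /=.
by rewrite telescope_sumr// s0 subr0.
Qed.

Lemma period_gt0 r s : periodic_blocks r s -> 0 < period r s.
Proof.
move=> [r0 s0 sincr _ _]; rewrite (periodE _ s0) -s0.
case: r r0 => // n _; elim: n => [|n IH]; first exact: sincr.
exact: lt_trans IH (sincr _).
Qed.

Lemma intensity_periodicz r s lam ell (k : int) u :
  intensity r s lam ell -> ell (u + k%:~R * period r s) = ell u.
Proof.
move=> [_ _ _ per _]; have pern n v : ell (v + n%:R * period r s) = ell v.
  elim: n v => [|n IH] v; first by rewrite mul0r addr0.
  by rewrite -[n.+1]addn1 natrD mulrDl mul1r addrA per IH.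
case: k => n; first exact: pern.
rewrite NegzE mulrNz mulNr.
by rewrite -[in RHS](subrK (n.+1%:R * period r s) u) pern.
Qed.

(** As the first [r] blocks tile one period, [ell] takes finitely many values;
    both its measurability and its boundedness come from this reduction. *)
Lemma intensity_reduce r s lam ell u :
  periodic_blocks r s -> intensity r s lam ell ->
  exists k i, [/\ (0 < i <= r)%N, block s i (u - k%:~R * period r s) &
    ell u = lam i / block_length s i].
Proof.
move=> hb hell; have T0 := period_gt0 hb; set T := period r s in T0 *.
have [r0 s0 sincr [scov _ _] _] := hb.
(* Blocks are closed on the right, so [u] is reduced into [(0, T]]. *)
pose k : int := Num.ceil (u / T) - 1.
have /andP[u0 uT] : 0 < u - k%:~R * T <= T.
  have /andP[h1 h2] := Num.Theory.ceil_itv (u / T).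
  apply/andP; split.
    by rewrite subr_gt0 -ltr_pdivlMr// /k intrD; move: h1; rewrite intrD.
  rewrite lerBlDr -[X in X + _]mul1r -mulrDl -ler_pdivrMr// /k intrD.
  by rewrite addrC subrK.
have : cover [set i | (0 < i)%N] (block s) (u - k%:~R * T).
  by rewrite scov /= in_itv/= u0.
move=> [i /= i0 ui]; exists k, i; split => //; last first.
  rewrite -(intensity_block hell i0 ui).
  by rewrite -mulNr -intrN (intensity_periodicz _ _ hell).
rewrite i0 /= leqNgt; apply/negP => ri.
move: ui; rewrite /block/= in_itv/= => /andP[+ _].
rewrite ltNge => /negP; apply.
rewrite (le_trans uT)// /T (periodE _ s0).
have smono m n : s m <= s (m + n)%N.
  elim: n => [|n IH]; first by rewrite addn0.
  by rewrite addnS (le_trans IH)// ltW.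
have -> : i.-1 = (r + (i.-1 - r))%N by rewrite subnKC// -ltnS prednK.
exact: smono.
Qed.

(** Each level set is a countable union of translated blocks. *)
Lemma intensity_measurable r s lam ell :
  periodic_blocks r s -> intensity r s lam ell -> measurable_fun setT ell.
Proof.
move=> hb hell _ B _; rewrite setTI.
pose F (k : int) : set R := \bigcup_(i in [set i |
    (0 < i <= r)%N /\ B (lam i / block_length s i)])
  `]s i.-1 + k%:~R * period r s, s i + k%:~R * period r s]%classic.
have blockE i k u : block s i (u - k%:~R * period r s) <->
    `]s i.-1 + k%:~R * period r s, s i + k%:~R * period r s]%classic u.
  by rewrite /block/= !in_itv/= ltrBrDr lerBlDr.
have -> : ell @^-1` B = \bigcup_k F k.
  apply/seteqP; split => [u /= Bu|u [k _ [i /= [ir Bi]]]].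
    have [k [i [ir ui eui]]] := intensity_reduce u hb hell.
    exists k => //; exists i => /=; first by rewrite -eui.
    exact/blockE.
  move=> /blockE ui; have /andP[i0 _] := ir.
  have := intensity_block hell i0 ui.
  rewrite -mulNr -intrN (intensity_periodicz _ _ hell) => eu.
  by rewrite /preimage/= eu.
apply: countable_bigcupT_measurable => [|k]; first exact: countableP.
by apply: bigcup_measurable => i _; exact: measurable_itv.
Qed.

Lemma intensity_bounded r s lam ell :
  periodic_blocks r s -> intensity r s lam ell ->
  exists C : R, forall u, ell u <= C.
Proof.
move=> hb hell.
exists (\sum_(i < r.+1) `|lam i / block_length s i|) => u.
have [k [i [/andP[i0 ir] _ ->]]] := intensity_reduce u hb hell.
have ir' : (i < r.+1)%N by [].
rewrite (bigD1 (Ordinal ir'))//= (le_trans (ler_norm _))// lerDl.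
exact: sumr_ge0.
Qed.

(** Translating both ends of a bounded interval preserves its length, and
    Lebesgue measure is determined by its values on such intervals. *)
Lemma lebesgue_measureD (c : R) (A : set R) : measurable A ->
  pushforward (@lebesgue_measure R)
    ((fun x => x + c) : measurableTypeR R -> measurableTypeR R) A
  = lebesgue_measure A.
Proof.
move=> mA; have mc : measurable_fun setT
    ((fun x => x + c) : measurableTypeR R -> measurableTypeR R).
  by apply: measurable_funD => //.
pose mc_mixin := isMeasurableFun.Build _ _ _ _ _ mc.
pose mc_pack : {mfun _ >-> _} :=
  HB.pack (fun x : measurableTypeR R => x + c : measurableTypeR R) mc_mixin.
apply/esym/(@lebesgue_measure_unique _ (pushforward lebesgue_measure mc_pack))
  => //= _ [[a b]] _ <-.
rewrite /pushforward /=.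
rewrite (_ : _ @^-1` _ = `]a - c, b - c]%classic); last first.
  by apply/seteqP; split => x /=; rewrite !in_itv/= ltrBlDr lerBrDr.
rewrite !lebesgue_measure_itv/= !lte_fin ltrD2r.
by case: ifP => // _; congr EFin; ring.
Qed.

Lemma intensity_integral_shift r s lam ell u v :
  periodic_blocks r s -> intensity r s lam ell ->
  (\int[lebesgue_measure]_(x in `](u + period r s)%R, (v + period r s)%R])
     (ell x)%:E =
   \int[lebesgue_measure]_(x in `]u, v]) (ell x)%:E)%E.
Proof.
move=> hb hell; set T := period r s.
have mell := intensity_measurable hb hell.
have mT : measurable_fun setT
    ((fun x => x + T) : measurableTypeR R -> measurableTypeR R).
  by apply: measurable_funD => //.
rewrite -(@eq_measure_integral _ _ _ _ _ (pushforward (@lebesgue_measure R)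
    ((fun x => x + T) : measurableTypeR R -> measurableTypeR R))); last first.
  by move=> A mA _; exact: (lebesgue_measureD T mA).
rewrite ge0_integral_pushforward//=.
- rewrite (_ : _ @^-1` _ = `]u, v]%classic).
    by apply: eq_integral => x _ /=; rewrite (intensity_periodic hell).
  by apply/seteqP; split => x /=; rewrite !in_itv/= ltrD2r lerD2r.
- by apply/measurable_EFinP; exact: measurable_funTS.
- by move=> x _; rewrite lee_fin ltW// (intensity_gt0 hell).
Qed.

Lemma intensity_integral_lty r s lam ell u v :
  periodic_blocks r s -> intensity r s lam ell ->
  (\int[lebesgue_measure]_(x in `]u, v]) (ell x)%:E < +oo)%E.
Proof.
move=> hb hell; have mell := intensity_measurable hb hell.
have [C hC] := intensity_bounded hb hell.
apply: (@le_lt_trans _ _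
    (\int[lebesgue_measure]_(x in `]u, v]) (cst C%:E) x)%E).
  apply: ge0_le_integral => //=.
  - by move=> x _; rewrite lee_fin ltW// (intensity_gt0 hell).
  - by apply/measurable_EFinP; exact: measurable_funTS.
  - by move=> x _; rewrite lee_fin.
rewrite integral_cst//= lebesgue_measure_itv/=.
by case: ifP => _; rewrite ?mule0 ?ltry// -EFinB -EFinM ltry.
Qed.

End Intensity.

(** * The mean of a Poisson count *)

Section PoissonMean.
Context d (Omega : measurableType d) (R : realType) (P : probability Omega R).
Local Open Scope ereal_scope.

Definition poisson_mean (rate : R) : \bar R :=
  \sum_(n <oo) n%:R%:E * poisson_prob rate 0 [set n].

Lemma poisson_prob1 (rate : R) (n : nat) : (0 < rate)%R ->
  poisson_prob rate 0 [set n] = (poisson_pmf rate n)%:E.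
Proof.
by move=> r0; rewrite /poisson_prob r0 esum_set1// lee_fin poisson_pmf_ge0.
Qed.

Lemma poisson_prob_sum1 (rate : R) :
  \sum_(n <oo) poisson_prob rate 0 [set n] = 1.
Proof.
rewrite -(@probability_setT _ _ _ (poisson_prob rate 0)).
transitivity (\sum_(n <oo | n \in [set: nat]) poisson_prob rate 0 [set n]).
  by apply: eq_eseriesl => n; rewrite in_setT.
rewrite -(@measure_bigcup _ _ _ (poisson_prob rate 0) setT
  (fun n => [set n]))//; last first.
  by move=> i j _ _ [n [/= -> ->]].
by congr (poisson_prob _ _ _); apply/seteqP; split => n //= _; exists n.
Qed.

(** For a positive rate, the identity
    [n.+1 * rate ^ n.+1 / n.+1! = rate * (rate ^ n / n!)] turns the series of
    the mean into [rate] times the total mass. *)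
Lemma poisson_mean_lty (rate : R) : poisson_mean rate < +oo.
Proof.
rewrite /poisson_mean; have [r0|r0] := ltP 0%R rate; last first.
  rewrite eseries0 ?ltry// => n _ _; rewrite /poisson_prob ltNge r0/= diracE.
  have [->|/eqP n0] := eqVneq n 0%N; first by rewrite mul0e.
  by rewrite memNset ?mule0// => /= /esym.
have f0 n : 0 <= n%:R%:E * poisson_prob rate 0 [set n].
  by rewrite mule_ge0// lee_fin.
rewrite nneseries_recl// mul0e add0e -(nneseries_addn 1%N f0).
rewrite (eq_eseriesr (g := fun n => rate%:E * poisson_prob rate 0 [set n])).
  by rewrite nneseriesZl// poisson_prob_sum1 mule1 ltry.
move=> n _; rewrite addn1 !poisson_prob1// -!EFinM /poisson_pmf r0; congr EFin.
rewrite factS natrM invfM exprS.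
have n0 : (n.+1%:R != 0 :> R)%R by rewrite pnatr_eq0.
transitivity ((n.+1%:R / n.+1%:R) *
    (rate * (rate ^+ n / n`!%:R * expR (- rate))))%R; first by ring.
by rewrite divff// mul1r.
Qed.

(** A count with a Poisson law may be infinite or not an integer only on a null
    event, because the masses of the integers already add up to 1; so its mean
    is a function of the parameter alone. *)
Lemma poisson_law_mean (m : \bar R) (N : Omega -> \bar R) :
  measurable_fun setT N -> (forall w, 0 <= N w) -> m < +oo ->
  poisson_law P m N -> \int[P]_w N w = poisson_mean (fine m).
Proof.
move=> mN N0 moo; rewrite /poisson_law lt_eqF// => PN.
pose F n : set Omega := [set w | N w = n%:R%:E].
have mF n : measurable (F n).
  have := mN measurableT [set n%:R%:E] (emeasurable_set1 _).
  by rewrite setTI.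
have tF : trivIset setT F.
  move=> i j _ _ [w [Ni Nj]].
  have [/eqP] : i%:R%:E = j%:R%:E :> \bar R by rewrite -Ni -Nj.
  by rewrite eqr_nat => /eqP.
have PF : P (\bigcup_n F n) = 1.
  rewrite measure_bigcup//= -(poisson_prob_sum1 (fine m)).
  rewrite (@eq_eseriesl _ _ xpredT); last by move=> n; rewrite in_setT.
  by apply: eq_eseriesr => n _; exact: PN.
transitivity (\int[P]_(w in \bigcup_n F n) N w).
  rewrite [LHS](@ge0_negligible_integral _ _ _ _ _ (~` \bigcup_n F n))//.
  - by rewrite setTD setCK.
  - exact/measurableC/bigcupT_measurable.
  - transitivity (1 - P (\bigcup_n F n)); last by rewrite PF subee.
    by apply: probability_setC; exact: bigcupT_measurable.
rewrite ge0_integral_bigcup//; last by exact: measurable_funTS.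
apply: eq_eseriesr => n _.
rewrite (eq_integral (cst n%:R%:E)); last by move=> w; rewrite inE.
rewrite integral_cst//; congr (_ * _); exact: PN.
Qed.

End PoissonMean.

(** * Ordered atoms and their counts *)

Section Counting.
Context (R : realType).
Local Open Scope ereal_scope.
Implicit Types (tau : int -> R) (B : set R).

Definition count_atoms tau B : \bar R := \esum_(k in setT) \d_(tau k) B.

Lemma count_atomsE tau B (D : set int) :
  (forall k, D k <-> B (tau k)) -> count_atoms tau B = \esum_(k in D) 1.
Proof.
move=> DB; rewrite [RHS]esum_mkcond; apply: eq_esum => k _; rewrite diracE.
have -> : (k \in D) = (tau k \in B).
  by apply/idP/idP; rewrite !inE => /DB.
by case: (_ \in _).
Qed.

Lemma esum_image_ord (n : nat) (e : nat -> int) : injective e ->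
  \esum_(k in e @` `I_n) 1 = n%:R%:E :> \bar R.
Proof.
move=> einj; rewrite esum_image; last by move=> i j _ _ /einj.
rewrite esum_fset//.
by rewrite -fsbig_ord sumEFin sumr_const card_ord.
Qed.

(** This and the next lemma bound a count by listing indices through an
    injection [e]: below when the listed atoms lie in [B], above when all the
    atoms in [B] are listed. *)
Lemma count_atoms_ge tau B (n : nat) (e : nat -> int) : injective e ->
  (forall i, (i < n)%N -> B (tau (e i))) -> n%:R%:E <= count_atoms tau B.
Proof.
move=> einj eB; rewrite -(esum_image_ord n einj) esum_mkcond.
apply: le_esum => k _; rewrite diracE; case: ifPn => //; rewrite inE.
by move=> [i /= /eB eiB <-]; rewrite mem_set.
Qed.

Lemma count_atoms_le tau B (n : nat) (e : nat -> int) : injective e ->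
  (forall k, B (tau k) -> exists2 i, (i < n)%N & e i = k) ->
  count_atoms tau B <= n%:R%:E.
Proof.
move=> einj Be; rewrite -(esum_image_ord n einj) [leRHS]esum_mkcond.
apply: le_esum => k _; rewrite diracE.
have [/set_mem/Be[i ilt ei]|_] := boolP (tau k \in B); last by case: ifPn.
by rewrite mem_set//; exists i.
Qed.

Lemma count_atoms_finite tau B :
  count_atoms tau B < +oo -> finite_set [set k | B (tau k)].
Proof.
rewrite (@count_atomsE _ _ [set k | B (tau k)])//.
apply: contraPP => Dinf; apply/negP; rewrite -leNgt leye_eq.
apply/eqP/eq_infty => t.
have [n tn] : exists n : nat, (t <= n%:R)%R.
  exists (Num.truncn `|t|).+1; rewrite (le_trans (ler_norm _))// ltW//.
  exact: truncnS_gt.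
have [F FD nF] := infinite_set_fset n Dinf.
apply: esum_ge; exists [set` F]; first by split=> //; exact: finite_fset.
rewrite fsbig_finite//= set_fsetK sumEFin big_const_seq count_predT.
by rewrite iter_addr_0 lee_fin (le_trans tn)// ler_nat.
Qed.

(** The atoms in [(0, v]] are the first positive ones, by monotonicity; this
    makes the position of the [n.+1]-st a matter of counting. *)
Lemma atom_pos_leE tau v (n : nat) : {homo tau : j k / (j <= k)%R} ->
  (tau 0 <= 0 < tau 1)%R ->
  (tau (Posz n.+1) <= v)%R = (n.+1%:R%:E <= count_atoms tau `]0%R, v]%classic).
Proof.
move=> tmono /andP[t0 t1]; pose e (i : nat) := Posz i.+1.
have einj : injective e by move=> i j [].
apply/idP/idP => [tv|].
  apply: (count_atoms_ge einj) => i ilt /=; rewrite in_itv/=.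
  by rewrite (lt_le_trans t1)?(le_trans _ tv) ?tmono.
apply: contraLR; rewrite -ltNge => vt; rewrite -ltNge.
apply: (@le_lt_trans _ _ n%:R%:E); last by rewrite lte_fin ltr_nat.
apply: (count_atoms_le einj) => k /=; rewrite in_itv/= => /andP[k0 kv].
have : (0 < k)%R.
  by rewrite ltNge; apply/negP => /tmono tk; rewrite ltNge (le_trans tk) in k0.
case: k k0 kv => [[|k]|]// k0 kv _; exists k => //.
rewrite ltnNge; apply/negP => nk; move: vt; rewrite ltNge (le_trans _ kv)//.
exact: tmono.
Qed.

(** The mirror image: the atoms in [(v, 0]] have indices [0, -1, -2, ...], and
    [tau (- n)] is among them exactly when there are at least [n.+1]. *)
Lemma atom_nonpos_leE tau v (n : nat) : {homo tau : j k / (j <= k)%R} ->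
  (tau 0 <= 0 < tau 1)%R ->
  (tau (- n%:Z)%R <= v)%R = (count_atoms tau `]v, 0%R]%classic < n.+1%:R%:E).
Proof.
move=> tmono /andP[t0 t1]; pose e (i : nat) : int := (- i%:Z)%R.
have einj : injective e by move=> i j /oppr_inj [].
apply/idP/idP => [tv|]; last first.
  apply: contraLR; rewrite -ltNge => vt; rewrite -leNgt.
  apply: (count_atoms_ge einj) => i ilt /=; rewrite in_itv/=.
  rewrite (le_trans _ t0) ?andbT; last by apply: tmono; rewrite oppr_le0.
  by rewrite (lt_le_trans vt)// tmono// lerN2 lez_nat.
apply: (@le_lt_trans _ _ n%:R%:E); last by rewrite lte_fin ltr_nat.
apply: (count_atoms_le einj) => k /=; rewrite in_itv/= => /andP[vk k0].
have : (k < 1)%R.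
  rewrite ltNge; apply/negP => /tmono tk.
  by move: t1; rewrite ltNge (le_trans tk).
rewrite -[1%R]add0r ltzD1 => kle0.
exists `|k|%N; last by rewrite /e abszE ler0_norm ?opprK.
rewrite -ltz_nat abszE ler0_norm// ltNge -[n%:Z]opprK lerN2.
by apply/negP => /tmono; rewrite leNgt (le_lt_trans tv).
Qed.

End Counting.

(** * Integration over an independent event *)

Section MeasureTools.
Context d (Omega : measurableType d) (R : realType) (P : probability Omega R).
Local Open Scope ereal_scope.

Lemma measure_ae_eq (A B : set Omega) : measurable A -> measurable B ->
  {ae P, forall w, A w <-> B w} -> P A = P B.
Proof.
move=> mA mB AB; rewrite -[A]setIT -[B]setIT -!(integral_indic P measurableT)//.
apply: ge0_ae_eq_integral => //.
- by apply/measurable_EFinP.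
- by apply/measurable_EFinP.
apply: filterS AB => w AB _; rewrite !indicE.
by congr ((nat_of_bool _)%:R%:E); apply/idP/idP; rewrite !inE => /AB.
Qed.

(** Under the restriction of [P] to [A], the law of [Z] is [P A] times the law
    of [J], and integrals are determined by laws. *)
Lemma ge0_integral_indep (Z J : {RV P >-> R}) (A : set Omega) (g : R -> R) :
  measurable A ->
  (forall C, measurable C -> P (Z @^-1` C `&` A) = distribution P J C * P A) ->
  measurable_fun setT g -> (forall x, (0 <= g x)%R) ->
  \int[P]_(w in A) (g (Z w))%:E = 'E_P[g \o J] * P A.
Proof.
move=> mA ind mg g0.
have mgZ (W : {RV P >-> R}) : measurable_fun setT (fun w => (g (W w))%:E).
  by apply/measurable_EFinP; exact: measurableT_comp.
transitivity (\int[mrestr P mA]_w (g (Z w))%:E).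
  rewrite [RHS](@ge0_negligible_integral _ _ _ _ _ (~` A))//.
  - rewrite setTD setCK; apply: eq_measure_integral => B mB BA.
    by rewrite /= /mrestr setIidl.
  - exact: measurableC.
  - by move=> w _; rewrite lee_fin.
  - by rewrite /= /mrestr setICl measure0.
have PA0 : (0 <= fine (P A))%R by rewrite fine_ge0.
have PAfin : P A = (fine (P A))%:E by rewrite fineK// fin_num_measure.
pose k : {nonneg R} := NngNum PA0.
transitivity (\int[mscale k (distribution P J)]_x (g x)%:E).
  rewrite -(@ge0_integral_pushforward _ _ _ _ _ Z _ (mrestr P mA) setT
    (EFin \o g))//=; first last.
  - by move=> x _; rewrite lee_fin.
  - exact/measurable_EFinP.
  apply: eq_measure_integral => C mC _.
  by rewrite /= /pushforward /mrestr ind// /mscale /= -PAfin muleC.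
rewrite ge0_integral_mscale//; last by move=> x _; rewrite lee_fin.
  rewrite /= -PAfin muleC unlock; congr (_ * _).
  rewrite (@ge0_integral_pushforward _ _ _ _ _ J _ P setT (EFin \o g))//.
    exact/measurable_EFinP.
  by move=> x _; rewrite lee_fin.
exact/measurable_EFinP.
Qed.

Lemma Lfun2_sqr (X : {RV P >-> R}) :
  'E_P[fun w => (X w ^+ 2)%R] < +oo -> (X : Omega -> R) \in Lfun P 2%:E.
Proof.
move=> X2; rewrite inE; apply/andP; split; rewrite inE//=.
rewrite /finite_norm unlock /Lnorm poweR_lty//.
move: X2; rewrite unlock; congr (_ < _); apply: eq_integral => w _ /=.
by rewrite powR_mulrn// real_normK ?num_real.
Qed.

End MeasureTools.

(** * Campbell's formula for marked atoms *)

Section Campbell.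
Context d (Omega : measurableType d) (R : realType) (P : probability Omega R).
Variables (M : R.-ker Omega ~> R) (tau jump : int -> {RV P >-> R})
  (J : {RV P >-> R}).
Hypotheses (htau : atoms M tau) (hjump : iid_copies jump J)
  (hjumpM : independent P (sigma_field setT jump) (sigma_kernel M)).
Local Open Scope ereal_scope.

Lemma count_event (B : set R) (N : set \bar R) : measurable B ->
  measurable N -> sigma_kernel M [set w | N (M w B)].
Proof.
move=> mB mN; apply: sub_sigma_algebra; exists B => //; exists N => //.
by rewrite setTI.
Qed.

Lemma measurable_lte (c : \bar R) : measurable [set x : \bar R | x < c].
Proof.
rewrite (_ : [set _ | _] = `]-oo, c[%classic); first exact: emeasurable_itv.
by apply/seteqP; split => x /=; rewrite in_itv.
Qed.

Lemma measurable_gee (c : \bar R) : measurable [set x : \bar R | c <= x].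
Proof.
rewrite (_ : [set _ | _] = `[c, +oo[%classic); first exact: emeasurable_itv.
by apply/seteqP; split => x /=; rewrite in_itv/= andbT.
Qed.

Lemma sigma_kernel_measurable (E : set Omega) :
  sigma_kernel M E -> measurable E.
Proof.
apply: smallest_sub; first exact: sigma_algebra_measurable.
move=> _ [B /= mB [N mN <-]]; exact: (measurable_kernel M B mB).
Qed.

Lemma homo_le_int (f : int -> R) : (forall k, f k <= f (k + 1))%R ->
  {homo f : j k / (j <= k)%R}.
Proof.
move=> fS j k; rewrite -subr_ge0 => jk.
have -> : k = (j + `|k - j|%N%:Z)%R by rewrite abszE ger0_norm// subrKC.
elim: `|k - j|%N => [|n IH]; first by rewrite addr0.
by rewrite (le_trans IH)// -addn1 PoszD addrA.
Qed.

(** The marks are assumed independent of the counts of [M], not of the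
    positions [tau]. The independence is carried over by expressing events on
    [tau k] through counts of atoms between 0 and a level. *)
Lemma atom_le_event (k : int) (v : R) :
  exists2 E, sigma_kernel M E & {ae P, forall w, (tau k w <= v)%R <-> E w}.
Proof.
case: (intP k) => [|n|n].
- exists [set w | M w `]v, 0%R]%classic < 1%:E].
    exact: (count_event _ (measurable_lte _)).
  apply: filterS htau => w [t1 t2 Mw]; rewrite /= Mw//.
  have := @atom_nonpos_leE _ (fun k => tau k w) v 0 (homo_le_int t1) t2.
  by rewrite oppr0 => ->.
- exists [set w | n.+1%:R%:E <= M w `]0%R, v]%classic].
    exact: (count_event _ (measurable_gee _)).
  apply: filterS htau => w [t1 t2 Mw]; rewrite /= Mw//.
  by rewrite (@atom_pos_leE _ (fun k => tau k w) v n (homo_le_int t1) t2).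
- exists [set w | M w `]v, 0%R]%classic < n.+2%:R%:E].
    exact: (count_event _ (measurable_lte _)).
  apply: filterS htau => w [t1 t2 Mw]; rewrite /= Mw//.
  by rewrite (@atom_nonpos_leE _ (fun k => tau k w) v n.+1 (homo_le_int t1) t2).
Qed.

Definition atom_in (u v : R) (k : int) : set Omega :=
  [set w | (u < tau k w <= v)%R].

Lemma measurable_atom_in u v k : measurable (atom_in u v k).
Proof.
rewrite (_ : atom_in u v k = tau k @^-1` `]u, v]%classic).
  by rewrite -[X in measurable X]setTI; exact: measurable_funP.
by apply/seteqP; split => w /=; rewrite in_itv.
Qed.

Lemma mark_atom_indep (u v : R) (k : int) C : measurable C ->
  P (jump k @^-1` C `&` atom_in u v k) =
  distribution P J C * P (atom_in u v k).
Proof.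
move=> mC.
have [E ME tE] := atom_le_event k v; have [F MF tF] := atom_le_event k u.
have MD : sigma_kernel M (E `\` F).
  exact: (@measurableD _ (g_sigma_algebraType (\bigcup_(B in measurable)
    g_sigma_algebra_preimage (fun w => M w B)))).
have mjC : measurable (jump k @^-1` C).
  by rewrite -[X in measurable X]setTI; exact: measurable_funP.
have AE : {ae P, forall w, atom_in u v k w <-> (E `\` F) w}.
  apply: filterS2 tE tF => w tE tF; rewrite /atom_in /=; split.
    by move=> /andP[ut tv]; split; [exact/tE|move/tF; rewrite leNgt ut].
  by move=> [/tE -> /tF/negP]; rewrite -ltNge => ->.
have mD := sigma_kernel_measurable MD; have mA := measurable_atom_in u v k.
rewrite (measure_ae_eq mA mD AE).
rewrite (@measure_ae_eq _ _ _ P (jump k @^-1` C `&` atom_in u v k)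
  (jump k @^-1` C `&` (E `\` F))); first last.
- by apply: filterS AE => w AE; split => -[? /AE].
- exact: measurableI.
- exact: measurableI.
rewrite -(hjump.2 k C mC); apply: hjumpM => //.
apply: sub_sigma_algebra; exists k => //; exists C => //.
by rewrite setTI.
Qed.

(** Enumerating the integers by the naturals (odd numbers to negative integers)
    gives access to monotone convergence for sums over all atoms. *)
Lemma int_enum : exists e : nat -> int, set_bij setT setT e.
Proof.
exists (fun n => if odd n then Negz n./2 else Posz n./2); split => //.
  move=> m n _ _ /= mn; rewrite -[m]odd_double_half -[n]odd_double_half.
  by move: mn; case: (odd m); case: (odd n) => // -[->].
move=> [n|n] _.
  by exists n.*2 => //; rewrite odd_double doubleK.
by exists n.*2.+1 => //=; rewrite odd_double /= uphalf_double.
Qed.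

Lemma ge0_integral_esum_int (f : int -> Omega -> \bar R) :
  (forall k, measurable_fun setT (f k)) -> (forall k w, 0 <= f k w) ->
  measurable_fun setT (fun w => \esum_(k in setT) f k w) /\
  \int[P]_w (\esum_(k in setT) f k w) = \esum_(k in setT) \int[P]_w f k w.
Proof.
move=> mf f0; have [e ebij] := int_enum.
have fE : (fun w => \esum_(k in setT) f k w) =
          (fun w => \sum_(n <oo) f (e n) w).
  by apply/funext => w; rewrite (reindex_esum setT setT e)// nneseries_esumT.
rewrite fE; split.
  by apply: ge0_emeasurable_sum.
rewrite integral_nneseries// (reindex_esum setT setT e)// nneseries_esumT//.
by move=> n; exact: integral_ge0.
Qed.

Definition marked_sum (g : R -> R) (u v : R) (w : Omega) : \bar R :=
  \esum_(k in setT) (g (jump k w) * \1_(atom_in u v k) w)%:E.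

(** Campbell's formula: the means [E (g J) * P (u < tau k <= v)] add up over [k]
    to [E (g J)] times the mean number of atoms in [(u, v]]. *)
Lemma integral_marked_sum (g : R -> R) (u v : R) :
  measurable_fun setT g -> (forall x, 0 <= g x)%R -> 'E_P[g \o J] < +oo ->
  measurable_fun setT (marked_sum g u v) /\
  \int[P]_w marked_sum g u v w = 'E_P[g \o J] * \int[P]_w M w `]u, v]%classic.
Proof.
move=> mg g0 Egoo; have mA := measurable_atom_in u v.
have mgJ k : measurable_fun setT (fun w => g (jump k w)).
  exact: measurableT_comp.
have [|k w|mS ->] := ge0_integral_esum_int (f := fun k w =>
    (g (jump k w) * \1_(atom_in u v k) w)%:E).
- by move=> k; apply/measurable_EFinP; exact: measurable_funM.
- by rewrite lee_fin mulr_ge0.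
split => //.
have Eg0 : 0 <= 'E_P[g \o J] by apply: expectation_ge0 => w; exact: g0.
transitivity (\esum_(k in setT) 'E_P[g \o J] * P (atom_in u v k)).
  apply: eq_esum => k _; rewrite -(ge0_integral_indep (Z := jump k))//.
    2: exact: mark_atom_indep.
  rewrite [RHS]integral_mkcond; apply: eq_integral => w _.
  rewrite patchE indicE; case: ifPn => _; first by rewrite mulr1.
  by rewrite mulr0.
have [|k w|mcount countE] := ge0_integral_esum_int (f := fun k w =>
    (\1_(atom_in u v k) w)%:E).
- by move=> k; apply/measurable_EFinP.
- by rewrite lee_fin.
transitivity ('E_P[g \o J] * \esum_(k in setT) P (atom_in u v k)).
  have [e ebij] := int_enum.
  rewrite !(reindex_esum setT setT e)// -!nneseries_esumT//.
  - rewrite -[in RHS](@fineK _ 'E_P[g \o J]) ?ge0_fin_numE// -nneseriesZl//.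
    by apply: eq_eseriesr => n _; rewrite fineK// ge0_fin_numE.
  - by move=> n; rewrite mule_ge0.
congr (_ * _).
transitivity (\esum_(k in setT) \int[P]_w (\1_(atom_in u v k) w)%:E).
  by apply: eq_esum => k _; rewrite integral_indic// setIT.
rewrite -countE; apply: ge0_ae_eq_integral => //.
- exact: measurable_kernel.
- by move=> w _; exact: esum_ge0.
by apply: filterS htau => w [_ _ Mw] _; rewrite Mw//; apply: eq_esum.
Qed.

End Campbell.

(** * Mean increments of the marked process *)

Section MeanIncrements.
Context d (Omega : measurableType d) (R : realType) (P : probability Omega R).
Variables (M : R.-ker Omega ~> R) (tau jump : int -> {RV P >-> R})
  (J : {RV P >-> R}) (gamma : R) (S : R -> {RV P >-> R}).
Hypotheses (htau : atoms M tau) (hjump : iid_copies jump J)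
  (hjumpM : independent P (sigma_field setT jump) (sigma_kernel M))
  (hJ2 : ('E_P[fun w => (J w ^+ 2)%R] < +oo)%E)
  (hS : marked_poisson_process gamma tau jump S).
Local Open Scope ereal_scope.

Let pos (x : R) : R := Num.max x 0%R.
Let neg (x : R) : R := Num.max (- x)%R 0%R.

Lemma expectation_lty_le_norm (g : R -> R) : measurable_fun setT g ->
  (forall x, 0 <= g x <= `|x|)%R -> 'E_P[g \o J] < +oo.
Proof.
move=> mg gx; have PT : P setT \is a fin_num by rewrite fin_num_measure.
have /Lfun1_integrable/integrableP[_] := Lfun_subset12 PT (Lfun2_sqr hJ2).
apply: le_lt_trans; rewrite unlock; apply: ge0_le_integral => //.
- by move=> w _; rewrite lee_fin; have /andP[] := gx (J w).
- by apply/measurable_EFinP; exact: measurableT_comp.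
- by apply/measurable_EFinP; exact: measurableT_comp.
- by move=> w _; rewrite lee_fin; have /andP[] := gx (J w).
Qed.

(** The defining sum of the increments is a finitely supported one, equal to 0
    on infinite supports, so it is compared with the sum over all atoms only
    when finitely many of them lie in [(u, v]]. *)
Lemma marked_sumE (g : R -> R) u v w : (forall x, 0 <= g x)%R ->
  finite_set [set k | (u < tau k w <= v)%R] ->
  marked_sum tau jump g u v w =
  (\sum_(k \in [set k | (u < tau k w <= v)%R]) g (jump k w))%R%:E.
Proof.
move=> g0 fin; rewrite -fsumEFin// -esum_fset//; last first.
  by move=> k _; rewrite lee_fin.
rewrite [RHS]esum_mkcond; apply: eq_esum => k _; rewrite indicE.
have -> : (w \in atom_in tau u v k) =
          (k \in [set k | (u < tau k w <= v)%R]) by apply/idP/idP; rewrite !inE.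
by case: ifPn => _; rewrite ?mulr1 ?mulr0.
Qed.

(** Campbell's formula holds for nonnegative functions of the marks, hence the
    splitting of [J] into its positive and negative parts. *)
Lemma mean_increment (u v : R) : (u < v)%R ->
  \int[P]_w M w `]u, v]%classic < +oo ->
  'E_P[fun w => (S v w - S u w)%R] = (gamma * (v - u))%:E +
    ('E_P[pos \o J] * \int[P]_w M w `]u, v]%classic -
     'E_P[neg \o J] * \int[P]_w M w `]u, v]%classic).
Proof.
move=> uv moo.
have mpos : measurable_fun setT pos by exact: measurable_maxr.
have mneg : measurable_fun setT neg by apply: measurable_maxr.
have pos0 x : (0 <= pos x)%R by rewrite /pos le_max lexx orbT.
have neg0 x : (0 <= neg x)%R by rewrite /neg le_max lexx orbT.
have Epos : 'E_P[pos \o J] < +oo.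
  apply: expectation_lty_le_norm => // x; rewrite pos0 /pos ge_max normr_ge0.
  by rewrite ler_norm.
have Eneg : 'E_P[neg \o J] < +oo.
  apply: expectation_lty_le_norm => // x; rewrite neg0 /neg ge_max normr_ge0.
  by rewrite -normrN ler_norm.
have [mFp Fp] := integral_marked_sum htau hjump hjumpM u v mpos pos0 Epos.
have [mFn Fn] := integral_marked_sum htau hjump hjumpM u v mneg neg0 Eneg.
have F0 g w : (forall x, 0 <= g x)%R -> 0 <= marked_sum tau jump g u v w.
  by move=> g0; apply: esum_ge0 => k _; rewrite lee_fin mulr_ge0.
have M0 : 0 <= \int[P]_w M w `]u, v]%classic by exact: integral_ge0.
have iF g : (forall x, 0 <= g x)%R -> 'E_P[g \o J] < +oo ->
    measurable_fun setT (marked_sum tau jump g u v) ->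
    \int[P]_w marked_sum tau jump g u v w =
      'E_P[g \o J] * \int[P]_w M w `]u, v]%classic ->
    P.-integrable setT (marked_sum tau jump g u v).
  move=> g0 Eg mF FE; apply/integrableP; split => //.
  under eq_integral do rewrite gee0_abs ?F0//.
  have Eg0 : 0 <= 'E_P[g \o J] by apply: expectation_ge0 => w; exact: g0.
  by rewrite FE lte_mul_pinfty// ge0_fin_numE.
have iFp := iF _ pos0 Epos mFp Fp; have iFn := iF _ neg0 Eneg mFn Fn.
rewrite -Fp -Fn -integralB// -[X in X + _]mule1 -(@probability_setT _ _ _ P).
rewrite -integral_cst// -integralD//; last 2 first.
- exact: finite_measure_integrable_cst.
- exact: integrableB.
have iM : P.-integrable setT (fun w => M w `]u, v]%classic).
  apply/integrableP; split; first exact: measurable_kernel.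
  by under eq_integral do rewrite gee0_abs//.
rewrite unlock; apply: ae_eq_integral => //.
- by apply/measurable_EFinP; exact: measurable_funB.
- by apply: emeasurable_funD => //; exact: emeasurable_funB.
apply: filterS3 hS htau (integrable_ae measurableT iM).
move=> w [_ Sw] [_ _ Mw] /(_ I) Mfin _.
(* A count with finite mean is almost surely finite. *)
have fin : finite_set [set k | (u < tau k w <= v)%R].
  rewrite (_ : [set k | _] = [set k | `]u, v]%classic (tau k w)]).
    apply: count_atoms_finite; rewrite /count_atoms -Mw//.
    by rewrite -ge0_fin_numE.
  by apply/seteqP; split => k /=; rewrite in_itv.
rewrite /= (Sw _ _ uv) !marked_sumE// -EFinB -EFinD; congr (_ + _)%R%:E.
apply/eqP; rewrite eq_sym subr_eq -fsbig_split//=; apply/eqP.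
apply: eq_fsbigr => k _; rewrite /pos /neg; case: (leP (jump k w) 0%R) => j0.
  by rewrite max_l ?oppr_ge0// subrr.
by rewrite max_r ?oppr_le0 ?addr0// ltW.
Qed.

End MeanIncrements.

(** * Means of Stieltjes sums and of their limits *)

Section StieltjesMeans.
Context d (Omega : measurableType d) (R : realType) (P : probability Omega R).
Local Open Scope ereal_scope.

Lemma expectation_lincomb (n : nat) (c : 'I_n -> R) (Z : 'I_n -> Omega -> R) :
  (forall j, Z j \in Lfun P 1) ->
  'E_P[fun w => (\sum_j Z j w * c j)%R] = \sum_j 'E_P[Z j] * (c j)%:E.
Proof.
move=> LZ; have LZc j : (fun w => Z j w * c j)%R \in Lfun P 1.
  by apply: Lfun_scale.
have iZ j : P.-integrable setT (fun w => (Z j w * c j)%:E).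
  exact/Lfun1_integrable.
rewrite unlock; under eq_integral do rewrite -sumEFin.
rewrite integral_sum//; apply: eq_bigr => j _.
under eq_integral do rewrite EFinM.
by rewrite integralZr//; exact/Lfun1_integrable.
Qed.

(** Hoelder's inequality against the constant 1, whose norm is 1 under a
    probability. *)
Lemma expectation_L2_dist (f g : Omega -> R) :
  f \in Lfun P 2%:E -> g \in Lfun P 2%:E ->
  `|'E_P[f] - 'E_P[g]| <= Lnorm P 2%:E (fun w => (f w - g w)%:E).
Proof.
move=> f2 g2.
have PT : P setT \is a fin_num by rewrite fin_num_measure.
have f1 := Lfun_subset12 PT f2; have g1 := Lfun_subset12 PT g2.
rewrite -expectationB//; set h := (f \- g)%R.
have ih : P.-integrable setT (EFin \o h).
  by apply/Lfun1_integrable; rewrite /h rpredB.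
have mh : measurable_fun setT h.
  by apply/measurable_EFinP; exact: measurable_int ih.
rewrite unlock (le_trans (le_abse_integral _ _ _))//.
  exact: measurable_int ih.
have N1 : Lnorm P 2%:E (EFin \o cst 1%R) = 1.
  rewrite Lnorm_cst1; transitivity (P setT `^ 2^-1) => //.
  by rewrite probability_setT poweR1r.
have := @hoelder _ _ _ P h (cst 1%R) 2 2 mh (measurable_cst _).
rewrite Lnorm1 N1 mule1.
have half : (2^-1 + 2^-1 = 1 :> R)%R by rewrite [RHS]splitr !div1r.
move=> /(_ _ _ half) => /(_ _ _)/le_trans H; apply: le_trans; last exact: H.
by under [leRHS]eq_integral do rewrite /= mulr1.
Qed.

End StieltjesMeans.

Section TaggedPartitions.
Context (R : realType).

Lemma tagged_partition_exists (a b delta : R) : a < b -> 0 < delta ->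
  exists u xi, tagged_partition a b delta u xi.
Proof.
move=> ab d0; pose n := (Num.truncn ((b - a) / delta)).+1.
pose h := (b - a) / n%:R.
have n0 : 0 < n%:R :> R by rewrite ltr0n.
have h0 : 0 < h by rewrite divr_gt0// subr_gt0.
have hd : h < delta.
  by rewrite ltr_pdivrMr// mulrC -ltr_pdivrMr// truncnS_gt.
pose g (i : nat) := a + i%:R * h.
pose u := [seq g i | i <- iota 1 n].
have su : size u = n by rewrite size_map size_iota.
have nthu i : (i < n)%N -> nth b u i = g i.+1.
  by move=> ilt; rewrite (nth_map 0%N) ?size_iota// nth_iota.
have nthau i : (i < n)%N -> nth b (a :: u) i = g i.
  case: i => [|i] ilt /=; first by rewrite /g mul0r addr0.
  by rewrite nthu// ltnW.
have gS i : g i.+1 = g i + h by rewrite /g -natr1 mulrDl mul1r addrA.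
(* Every cell is tagged at its right end. *)
exists u, u; split => //.
  split.
    apply/(pathP b) => i; rewrite su => ilt.
    by rewrite nthau// nthu// gS ltrDl.
  rewrite (last_nth b) su /= nthu// /g /h mulrC divfK; last by rewrite gt_eqF.
  by rewrite addrC subrK.
move=> i; rewrite su => ilt; rewrite nthau// nthu// gS.
split; first by rewrite lexx lerDl ltW.
by rewrite addrC addKr.
Qed.

Lemma nth_shift (T b : R) (u : seq R) i :
  nth (b + T) [seq x + T | x <- u] i = nth b u i + T.
Proof.
have [ilt|ige] := ltnP i (size u); first by rewrite (nth_map b).
by rewrite !nth_default// size_map.
Qed.

Lemma tagged_partition_shift (T a b delta : R) u xi :
  tagged_partition a b delta u xi ->
  tagged_partition (a + T) (b + T) delta [seq x + T | x <- u]
    [seq x + T | x <- xi].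
Proof.
move=> [[pu /eqP lu] sxi cells]; split; rewrite ?size_map//.
  split; last by rewrite (last_map (+%R^~ T)) lu.
  rewrite [path _ _ _](@path_map _ _ (+%R^~ T) <%R).
  by apply: sub_path pu => x y xy /=; rewrite ltrD2r.
move=> i iu; have [/andP[c1 c2] c3] := cells _ iu.
rewrite -[a + T :: _]/[seq x + T | x <- a :: u] !nth_shift !lerD2r c1 c2.
by split=> //; rewrite opprD addrACA subrr addr0.
Qed.

End TaggedPartitions.

Section PeriodicMeans.
Context d (Omega : measurableType d) (R : realType) (P : probability Omega R).
Variables (p : nat) (S : R -> Omega -> R) (T : R).
Hypotheses (S2 : forall t, S t \in Lfun P 2%:E)
  (ES : forall u v, u <= v -> ('E_P[fun w => (S (v + T) w - S (u + T) w)%R] =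
                               'E_P[fun w => (S v w - S u w)%R])%E).
Implicit Types (f : R -> 'cV[R]_p) (X : Omega -> 'cV[R]_p).

Let S1 t : S t \in Lfun P 1.
Proof. by apply: Lfun_subset12 => //; rewrite fin_num_measure. Qed.

Lemma stieltjes_sum_L2 f a b u xi : L2_vector P (stieltjes_sum f S a b u xi).
Proof.
move=> i.
rewrite (_ : (fun w => _) = \sum_(j < size u)
  ((f (nth b xi j) i 0) \o* (S (nth b u j) \- S (nth b (a :: u) j)))).
  apply: rpred_sum => [|le12 j _]; first by rewrite lee1n.
  apply: Lfun_scale; first by rewrite ler1n.
  by rewrite rpredB// lee1n.
apply/funext => w; rewrite /stieltjes_sum summxE fct_sumE.
by apply: eq_bigr => j _; rewrite !mxE.
Qed.

Lemma expectation_stieltjes_sum f a b u xi i :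
  'E_P[fun w => stieltjes_sum f S a b u xi w i 0%R]%E =
  (\sum_(j < size u)
    'E_P[fun w => (S (nth b u j) w - S (nth b (a :: u) j) w)%R] *
    (f (nth b xi j) i 0)%:E)%E.
Proof.
rewrite (_ : (fun w => _) = (fun w => \sum_(j < size u)
  (S (nth b u j) w - S (nth b (a :: u) j) w) * f (nth b xi j) i 0)).
  by apply: expectation_lincomb => j; rewrite rpredB.
apply/funext => w; rewrite /stieltjes_sum summxE.
by apply: eq_bigr => j _; rewrite !mxE.
Qed.

(** The only place where the periodicity of the mean increments enters. *)
Lemma expectation_stieltjes_sum_shift f f' a b delta u xi i :
  (forall x, f' (x + T) = f x) -> tagged_partition a b delta u xi ->
  ('E_P[fun w => stieltjes_sum f' S (a + T)%R (b + T)%R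
     [seq (x + T)%R | x <- u] [seq (x + T)%R | x <- xi] w i 0%R] =
  'E_P[fun w => stieltjes_sum f S a b u xi w i 0%R])%E.
Proof.
move=> ff' [_ sxi cells]; rewrite !expectation_stieltjes_sum size_map.
apply: eq_bigr => j _; rewrite -[a + T :: _]/[seq x + T | x <- a :: u].
rewrite !nth_shift ff'; congr (_ * _)%E.
by have [/andP[c1 c2] _] := cells _ (ltn_ord j); exact: ES (le_trans c1 c2).
Qed.

(** Shared by both passages to the limit: [Z] and [Z'] approximate [X] and [X']
    and have equal means. *)
Lemma L2_mean_close X Z X' Z' i (eps : R) :
  L2_vector P X -> L2_vector P Z -> L2_vector P X' -> L2_vector P Z' ->
  (L2_dist P Z X i < eps%:E)%E -> (L2_dist P Z' X' i < eps%:E)%E ->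
  ('E_P[fun w => Z w i 0%R] = 'E_P[fun w => Z' w i 0%R])%E ->
  (`|'E_P[fun w => X w i 0%R] - 'E_P[fun w => X' w i 0%R]| < (2 * eps)%:E)%E.
Proof.
move=> X2 Z2 X2' Z2' ZX ZX' EZ.
have PT : P setT \is a fin_num by rewrite fin_num_measure.
have fin (W : Omega -> 'cV[R]_p) : L2_vector P W ->
    'E_P[fun w => W w i 0%R]%E \is a fin_num.
  by move=> W2; apply: expectation_fin_num; exact: Lfun_subset12 (W2 i).
have := le_lt_trans (expectation_L2_dist (Z2 i) (X2 i)) ZX.
have := le_lt_trans (expectation_L2_dist (Z2' i) (X2' i)) ZX'.
rewrite -EZ -(fineK (fin _ X2)) -(fineK (fin _ Z2)) -(fineK (fin _ X2')).
rewrite -!EFinB !abse_EFin !lte_fin.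
rewrite !ltr_norml => /andP[? ?] /andP[? ?]; apply/andP; split; lra.
Qed.

Lemma expectation_eq_close X X' i : L2_vector P X -> L2_vector P X' ->
  (forall eps : R, 0 < eps ->
    (`|'E_P[fun w => X w i 0%R] - 'E_P[fun w => X' w i 0%R]|
      < (2 * eps)%:E)%E) ->
  ('E_P[fun w => X w i 0%R] = 'E_P[fun w => X' w i 0%R])%E.
Proof.
move=> X2 X2' close.
have PT : P setT \is a fin_num by rewrite fin_num_measure.
have fin (W : Omega -> 'cV[R]_p) : L2_vector P W ->
    'E_P[fun w => W w i 0%R]%E \is a fin_num.
  by move=> W2; apply: expectation_fin_num; exact: Lfun_subset12 (W2 i).
move: close; rewrite -(fineK (fin _ X2)) -(fineK (fin _ X2')) -EFinB abse_EFin.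
move=> close; congr EFin; apply/eqP; rewrite -subr_eq0 -normr_le0 leNgt.
apply/negP => x0; have := close _ (divr_gt0 x0 (ltr0n R 2)).
by rewrite lte_fin mulrC divfK ?pnatr_eq0// ltxx.
Qed.

Lemma expectation_stieltjes_shift f f' a b I I' i : a < b ->
  (forall x, f' (x + T) = f x) ->
  is_stieltjes_integral P f S a b I ->
  is_stieltjes_integral P f' S (a + T) (b + T) I' ->
  ('E_P[fun w => I w i 0%R] = 'E_P[fun w => I' w i 0%R])%E.
Proof.
move=> ab ff' [I2 If] [I2' If']; apply: expectation_eq_close => // eps eps0.
have [delta d0 dI] := If i eps eps0; have [delta' d0' dI'] := If' i eps eps0.
(* The mesh must be fine enough for both integrals, since one partition and
   its translate serve for the two. *)
have mind0 : 0 < Num.min delta delta' by rewrite lt_min d0.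
have [u [xi uxi]] := tagged_partition_exists ab mind0.
have weaken (e : R) : Num.min delta delta' <= e -> tagged_partition a b e u xi.
  move=> le_e; have [pu sxi cells] := uxi; split => // j /cells[? lt_e].
  by split => //; exact: lt_le_trans le_e.
have u1 : tagged_partition a b delta u xi by apply: weaken; rewrite ge_min lexx.
have u2 : tagged_partition a b delta' u xi.
  by apply: weaken; rewrite ge_min lexx orbT.
apply: (L2_mean_close _ (stieltjes_sum_L2 f a b u xi) _
    (stieltjes_sum_L2 f' (a + T) (b + T) [seq x + T | x <- u]
      [seq x + T | x <- xi]) (dI _ _ u1)
    (dI' _ _ (tagged_partition_shift T u2))) => //.
by rewrite (expectation_stieltjes_sum_shift _ ff' u1).
Qed.

Lemma expectation_improper_shift f f' t X X' i :
  (forall x, f' (x + T) = f x) ->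
  is_improper_integral P f S t X ->
  is_improper_integral P f' S (t + T) X' ->
  ('E_P[fun w => X w i 0%R] = 'E_P[fun w => X' w i 0%R])%E.
Proof.
move=> ff' [X2 [I If IX]] [X2' [I' If' IX']].
apply: expectation_eq_close => // eps eps0.
have lt_eps : \forall y \near (0%E : \bar R), (y < eps%:E)%E.
  by apply: open_ereal_lt'; rewrite lte_fin.
(* A neighbourhood of [-oo] contains all points below some bound; [s] is taken
   below [m] with [s + T] below [m']. *)
have [m [_ Hm]] := IX i _ lt_eps; have [m' [_ Hm']] := IX' i _ lt_eps.
pose s := Num.min t (Num.min m (m' - T)) - 1.
have [st sm sm'] : [/\ s < t, s < m & s + T < m'].
  have := lexx (Num.min t (Num.min m (m' - T))).
  by rewrite {2}/Order.min !le_min => /and3P[? ? ?]; rewrite /s; split; lra.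
have st' : s + T < t + T by rewrite ltrD2r.
apply: (L2_mean_close X2 (If _ st).1 X2' (If' _ st').1 (Hm _ sm) (Hm' _ sm')).
exact: expectation_stieltjes_shift (If _ st) (If' _ st').
Qed.

End PeriodicMeans.

(** * Periodicity of the mean increments *)

Section SemiLevy.
Context d (Omega : measurableType d) (R : realType) (P : probability Omega R).
Variables (r : nat) (s lam : nat -> R) (ell : R -> R) (M : R.-ker Omega ~> R)
  (tau jump : int -> {RV P >-> R}) (J : {RV P >-> R}) (gamma : R)
  (S : R -> {RV P >-> R}).
Hypotheses (hblocks : periodic_blocks r s) (hell : intensity r s lam ell)
  (hM : poisson_random_measure P M
          (fun B => \int[lebesgue_measure]_(u in B) (ell u)%:E)%E)
  (htau : atoms M tau) (hJ2 : ('E_P[fun w => (J w ^+ 2)%R] < +oo)%E)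
  (hjump : iid_copies jump J)
  (hjumpM : independent P (sigma_field setT jump) (sigma_kernel M))
  (hS : marked_poisson_process gamma tau jump S).
Local Open Scope ereal_scope.

Lemma mean_count u v : \int[P]_w M w `]u, v]%classic =
  poisson_mean (fine (\int[lebesgue_measure]_(x in `]u, v]) (ell x)%:E)).
Proof.
apply: poisson_law_mean.
- exact: measurable_kernel.
- by move=> w; exact: measure_ge0.
- exact: intensity_integral_lty hblocks hell.
- exact: hM.1.
Qed.

Lemma mean_increment_periodic u v : (u <= v)%R ->
  'E_P[fun w => (S (v + period r s) w - S (u + period r s) w)%R] =
  'E_P[fun w => (S v w - S u w)%R].
Proof.
rewrite le_eqVlt => /predU1P[->|uv].
  by congr expectation; apply/funext => w; rewrite !subrr.
have Moo u' v' : \int[P]_w M w `]u', v']%classic < +oo.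
  by rewrite mean_count poisson_mean_lty.
rewrite !(mean_increment htau hjump hjumpM hJ2 hS)//; last by rewrite ltrD2r.
rewrite !mean_count (intensity_integral_shift u v hblocks hell).
by congr ((gamma * _)%:E + _); rewrite opprD addrACA subrr addr0.
Qed.

End SemiLevy.

Theorem lemma4p1 (R : realType) (d : measure_display)
    (Omega : measurableType d) (P : probability Omega R)
    (r : nat) (s lam : nat -> R) (ell : R -> R)
    (M : R.-ker Omega ~> R) (tau : int -> {RV P >-> R})
    (J : {RV P >-> R}) (jump : int -> {RV P >-> R})
    (gamma : R) (S : R -> {RV P >-> R})
    (p q : nat) (a b : nat -> R)
    (X : R -> Omega -> 'cV[R]_p) (Y : R -> Omega -> R)
    (hblocks : periodic_blocks r s)
    (hell : intensity r s lam ell)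
    (hM : poisson_random_measure P M
            (fun B => \int[lebesgue_measure]_(u in B) (ell u)%:E)%E)
    (htau : atoms M tau)
    (hJ2 : ('E_P[fun w => (J w ^+ 2)%R] < +oo)%E)
    (hjump : iid_copies jump J)
    (hjumpM : independent P (sigma_field setT jump) (sigma_kernel M))
    (hS : marked_poisson_process gamma tau jump S)
    (hsub : second_order_subordinator S)
    (hcarma : carma_coefficients p q a b)
    (hX : forall t : R, is_improper_integral P
            (fun u => expmx ((t - u) *: carma_mx p a) *m carma_input p)
            S t (X t))
    (hcausal : forall t : R, independent P
            (sigma_field setT (fun (i : 'I_p) w => X t w i 0))
            (sigma_field [set v | t < v] (fun v w => S v w - S t w)))
    (hY : forall t w, Y t w = ((carma_output p b)^T *m X t w) 0 0) :
  (forall t : R, mean_vector P (X (t + period r s)) = mean_vector P (X t)) /\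
  (forall t : R, 'E_P[Y (t + period r s)%R] = 'E_P[Y t])%E.
Proof.
have S2 t : (S t : Omega -> R) \in Lfun P 2%:E := Lfun2_sqr (hsub.2 t).
have ES := mean_increment_periodic hblocks hell hM htau hJ2 hjump hjumpM hS.
have EX t i : ('E_P[fun w => X (t + period r s)%R w i 0%R] =
               'E_P[fun w => X t w i 0%R])%E.
  apply/esym/(expectation_improper_shift S2 ES i _ (hX t) (hX _)) => x.
  by rewrite opprD addrACA subrr addr0.
split=> t; first by apply/colP => i; rewrite !mxE EX.
have PT : P setT \is a fin_num by rewrite fin_num_measure.
have X1 t' i : (fun w => X t' w i 0%R) \in Lfun P 1.
  by have [X2 _] := hX t'; exact: Lfun_subset12 (X2 i).
have EY t' :
    ('E_P[Y t'] = \sum_(j < p) 'E_P[fun w => X t' w j 0%R] * (b j)%:E)%E.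
  rewrite -(expectation_lincomb _ (X1 t')); congr expectation.
  apply/funext => w; rewrite hY mxE; apply: eq_bigr => j _.
  by rewrite !mxE mulrC.
by rewrite !EY; apply: eq_bigr => j _; rewrite EX.
Qed.
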